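(* Let $A\in\mathbb{R}^{n\times d}$, $b\in\mathbb{R}^n$, and let $S\in\mathbb{R}^{m\times n}$ be an $\epsilon$-subspace embedding for the augmented matrix $(A\ \ b)\in\mathbb{R}^{n\times(d+1)}$ for some $0<\epsilon<1$. Let $SA=QR\hat V^T$ be a factorization of the form described in the context, with associated blocks $V_1\in\mathbb{R}^{d\times p}$, $R_{11}\in\mathbb{R}^{p\times p}$ and $R_{12}$, let $W=AV_1R_{11}^{-1}$ and let $y_*=\arg\min_{y\in\mathbb{R}^p}\|Wy-b\|_2$. If $R_{12}=0$ and $y_\tau=y_*$, then $x_\tau:=V_1R_{11}^{-1}y_\tau$ satisfies $x_\tau=x_{*,2}$, where $x_{*,2}$ is the minimal Euclidean norm solution of $\min_{x\in\mathbb{R}^d}\|Ax-b\|_2^2$, i.e. the vector of smallest Euclidean norm among all $x_*$ with $\|Ax_*-b\|_2=\min_x\|Ax-b\|_2$.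
   Context: Setting: $A\in\mathbb{R}^{n\times d}$ has rank $r$, with $n\ge d\ge r$. $\epsilon$-subspace embedding: $S\in\mathbb{R}^{m\times n}$ is an $\epsilon$-subspace embedding for $B\in\mathbb{R}^{n\times k}$ if $(1-\epsilon)\|y\|_2^2\le\|Sy\|_2^2\le(1+\epsilon)\|y\|_2^2$ for all $y\in\{Bz: z\in\mathbb{R}^k\}$. Factorization of the sketched matrix: $SA=QR\hat V^T$, where for some positive integer $p\le d$: - $R=\begin{pmatrix}R_{11}&R_{12}\\0&0\end{pmatrix}\in\mathbb{R}^{d\times d}$ with $R_{11}\in\mathbb{R}^{p\times p}$ nonsingular; - $Q=(Q_1\ \ Q_2)\in\mathbb{R}^{m\times d}$, where $Q_1\in\mathbb{R}^{m\times p}$ and $Q_2\in\mathbb{R}^{m\times(d-p)}$ have orthonormal columns; - $\hat V=(V_1\ \ V_2)\in\mathbb{R}^{d\times d}$ is orthogonal with $V_1\in\mathbb{R}^{d\times p}$. (In the paper's sketching algorithm, $y_\tau$ is the output of the iterative solver LSQR applied to $\min_y\|Wy-b\|_2$ and $x_\tau=V_1R_{11}^{-1}y_\tau$ is the returned vector; the hypothesis $y_\tau=y_*$ corresponds to relative tolerance $\tau_r=0$.) *)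

(* Defs.v *)
From mathcomp Require Import all_boot all_order all_algebra.
From mathcomp Require Import reals.

Set Implicit Arguments.
Unset Strict Implicit.
Unset Printing Implicit Defensive.

Import Order.TTheory GRing.Theory Num.Theory.

Local Open Scope ring_scope.

(* The norm `|v| of MathComp-Analysis on matrices is the sup norm, hence this
   definition. *)
Definition l2norm (R : realType) (n : nat) (v : 'cV[R]_n) : R :=
  Num.sqrt (\sum_(i < n) v i 0 ^+ 2).

Definition subspace_embedding (R : realType) (m n k : nat) (eps : R)
    (S : 'M[R]_(m, n)) (B : 'M[R]_(n, k)) : Prop :=
  forall y : 'cV[R]_n, (exists z : 'cV[R]_k, y = B *m z) ->
    (1 - eps) * l2norm y ^+ 2 <= l2norm (S *m y) ^+ 2 <=
    (1 + eps) * l2norm y ^+ 2.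

Definition orthonormal_columns (R : realType) (m k : nat)
    (U : 'M[R]_(m, k)) : Prop :=
  U^T *m U = 1%:M.

(* The block matrices Q, Rhat and V have p + (d - p) columns, a number equal
   to d (when p <= d) but not convertible to it. Orthogonality of V therefore
   asks for both products, of sizes p + (d - p) and d. Q1 and Q2 are each
   required to have orthonormal columns; Q1^T *m Q2 = 0 is not assumed. *)
Record sketch_factorization (R : realType) (m d p : nat) (SA : 'M[R]_(m, d))
    (Q1 : 'M[R]_(m, p)) (Q2 : 'M[R]_(m, d - p))
    (R11 : 'M[R]_p) (R12 : 'M[R]_(p, d - p))
    (V1 : 'M[R]_(d, p)) (V2 : 'M[R]_(d, d - p)) : Prop :=
  SketchFactorization {
    sf_p_gt0 : (0 < p)%N;
    sf_p_le : (p <= d)%N;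
    sf_eq : let Q := row_mx Q1 Q2 in
            let Rhat := block_mx R11 R12 0 0 : 'M[R]_(p + (d - p)) in
            let V := row_mx V1 V2 in
            SA = Q *m Rhat *m V^T;
    sf_R11 : R11 \in unitmx;
    sf_Q1 : orthonormal_columns Q1;
    sf_Q2 : orthonormal_columns Q2;
    sf_VtV : (row_mx V1 V2)^T *m row_mx V1 V2 = 1%:M;
    sf_VVt : row_mx V1 V2 *m (row_mx V1 V2)^T = 1%:M
  }.

Definition least_squares_solution (R : realType) (n k : nat)
    (B : 'M[R]_(n, k)) (b : 'cV[R]_n) (x : 'cV[R]_k) : Prop :=
  forall z : 'cV[R]_k, l2norm (B *m x - b) <= l2norm (B *m z - b).

Definition min_norm_solution (R : realType) (n k : nat)
    (B : 'M[R]_(n, k)) (b : 'cV[R]_n) (x : 'cV[R]_k) : Prop :=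
  least_squares_solution B b x /\
  forall z : 'cV[R]_k, least_squares_solution B b z -> l2norm x <= l2norm z.

(* Main.v *)
Require Import Defs.
From mathcomp Require Import all_boot all_order all_algebra.
From mathcomp Require Import reals lra.

(** Why the theorem holds.  When [R12 = 0] the sketch is
    [S A = Q1 R11 V1^T], with [Q1] of full column rank and [R11] invertible,
    so its null space is the one of [V1^T].  Since [eps < 1], the embedding
    loses no nonzero vector of the range of [A]; hence [A] and [S A] have the
    same null space, and [ker A = ker V1^T] is the range of [V2]
    ([sketch_kernel]).  Two facts follow.

    - Dropping the [V2] component of [z] does not change [A z], so
      [A z = W (R11 V1^T z)]: every residual of [A] is a residual of [W], and
      a least squares solution for [W] gives one for [A].

    - The vector [x = V1 R11^-1 y] lies in the range of [V1], the orthogonal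
      complement of [ker A].  All least squares solutions have the same image
      under [A], by strict convexity of the squared norm ([lss_image_eq]), so
      any other one is [x + w] with [w] in [ker A].  By Pythagoras its squared
      norm is [|x|^2 + |w|^2], which is minimal exactly when [w = 0]
      ([lss_orthogonal_kernel_min_norm]). *)

Set Implicit Arguments.
Unset Strict Implicit.
Unset Printing Implicit Defensive.

Import Order.TTheory GRing.Theory Num.Theory.

Local Open Scope ring_scope.

Lemma l2norm_ge0 (R : realType) n (v : 'cV[R]_n) : 0 <= l2norm v.
Proof. exact: sqrtr_ge0. Qed.

Lemma sqr_l2norm (R : realType) n (v : 'cV[R]_n) :
  l2norm v ^+ 2 = \sum_(i < n) v i 0 ^+ 2.
Proof. by rewrite sqr_sqrtr // sumr_ge0 // => i _; rewrite sqr_ge0. Qed.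

Lemma sqr_l2norm_eq0 (R : realType) n (v : 'cV[R]_n) :
  l2norm v ^+ 2 = 0 -> v = 0.
Proof.
rewrite sqr_l2norm => /eqP; rewrite psumr_eq0 => [/allP v0|i _]; last first.
  exact: sqr_ge0.
apply/colP => i; rewrite mxE; apply/eqP; rewrite -sqrf_eq0.
exact: v0 (mem_index_enum i).
Qed.

Lemma sqr_l2normZ (R : realType) n (a : R) (v : 'cV[R]_n) :
  l2norm (a *: v) ^+ 2 = a ^+ 2 * l2norm v ^+ 2.
Proof.
by rewrite !sqr_l2norm mulr_sumr; apply: eq_bigr => i _; rewrite mxE exprMn.
Qed.

Lemma ler_l2norm (R : realType) n k (u : 'cV[R]_n) (v : 'cV[R]_k) :
  (l2norm u <= l2norm v) = (l2norm u ^+ 2 <= l2norm v ^+ 2).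
Proof. by rewrite ler_sqr // nnegrE l2norm_ge0. Qed.

Lemma parallelogram (R : realType) n (u v : 'cV[R]_n) :
  l2norm (u + v) ^+ 2 + l2norm (u - v) ^+ 2
  = 2 * (l2norm u ^+ 2 + l2norm v ^+ 2).
Proof.
rewrite !sqr_l2norm -!big_split /= mulr_sumr; apply: eq_bigr => i _ /=.
by rewrite !mxE; lra.
Qed.

Lemma pythagoras (R : realType) n (u v : 'cV[R]_n) :
  u^T *m v = 0 -> l2norm (u + v) ^+ 2 = l2norm u ^+ 2 + l2norm v ^+ 2.
Proof.
move/matrixP/(_ 0 0); rewrite !mxE => uv0.
transitivity (l2norm u ^+ 2 + l2norm v ^+ 2 + 2 * \sum_j u^T 0 j * v j 0).
  rewrite !sqr_l2norm mulr_sumr -!big_split /=.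
  by apply: eq_bigr => i _ /=; rewrite !mxE; lra.
by rewrite uv0 mulr0 addr0.
Qed.

(** The squared residual is strictly convex as a function of [B x]: if two
    minimizers had distinct images, their midpoint would do strictly
    better, by the parallelogram identity. *)
Lemma lss_image_eq (R : realType) n k (B : 'M[R]_(n, k)) (b : 'cV[R]_n)
    (x z : 'cV[R]_k) :
  least_squares_solution B b x -> least_squares_solution B b z ->
  B *m x = B *m z.
Proof.
move=> lx lz; have := lx (2^-1 *: (x + z)); have := lz x.
have -> : B *m (2^-1 *: (x + z)) - b
          = 2^-1 *: ((B *m x - b) + (B *m z - b)).
  by rewrite -scalemxAr mulmxDr; apply/colP => i; rewrite !mxE; lra.
rewrite !ler_l2norm sqr_l2normZ => zx xm.
have := parallelogram (B *m x - b) (B *m z - b).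
have -> : B *m x - b - (B *m z - b) = B *m x - B *m z.
  by rewrite opprB addrA subrK.
move=> par; apply/eqP; rewrite -subr_eq0; apply/eqP/sqr_l2norm_eq0.
by have := sqr_ge0 (l2norm (B *m x - B *m z)); lra.
Qed.

(** Any other least squares solution is [x + w] with [w] in the null space of
    [B], and is longer than [x] by Pythagoras unless [w = 0]. *)
Lemma lss_orthogonal_kernel_min_norm (R : realType) n k (B : 'M[R]_(n, k))
    (b : 'cV[R]_n) (x : 'cV[R]_k) :
  least_squares_solution B b x ->
  (forall w : 'cV[R]_k, B *m w = 0 -> x^T *m w = 0) ->
  unique (min_norm_solution B b) x.
Proof.
move=> lx orth.
have pyth z : least_squares_solution B b z ->
    l2norm z ^+ 2 = l2norm x ^+ 2 + l2norm (z - x) ^+ 2.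
  move=> lz; rewrite -pythagoras ?[x + _]addrC ?subrK // orth //.
  by rewrite mulmxBr (lss_image_eq lx lz) subrr.
split; first split=> // z lz.
  by rewrite ler_l2norm (pyth z lz) lerDl sqr_ge0.
move=> z [lz minz]; apply/esym/eqP; rewrite -subr_eq0.
apply/eqP/sqr_l2norm_eq0; have := minz x lx; rewrite ler_l2norm (pyth z lz).
by have := sqr_ge0 (l2norm (z - x)); lra.
Qed.

Lemma subspace_embedding_inj (R : realType) m n k (eps : R)
    (S : 'M[R]_(m, n)) (B : 'M[R]_(n, k)) (z : 'cV[R]_k) :
  eps < 1 -> subspace_embedding eps S B -> S *m (B *m z) = 0 -> B *m z = 0.
Proof.
move=> eps1 emb SBz0; apply: sqr_l2norm_eq0.
have /andP[+ _] := emb (B *m z) (ex_intro _ z erefl).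
have -> : l2norm (S *m (B *m z)) ^+ 2 = 0.
  by rewrite SBz0 sqr_l2norm big1 // => i _; rewrite mxE expr0n.
rewrite pmulr_rle0 ?subr_gt0 // => le0.
by apply/eqP; rewrite eq_le le0 sqr_ge0.
Qed.

Lemma subspace_embedding_lsub (R : realType) m n k l (eps : R)
    (S : 'M[R]_(m, n)) (B : 'M[R]_(n, k)) (C : 'M[R]_(n, l)) :
  subspace_embedding eps S (row_mx B C) -> subspace_embedding eps S B.
Proof.
move=> emb _ [z ->]; apply: emb; exists (col_mx z 0).
by rewrite mul_row_col mulmx0 addr0.
Qed.

(** Both [S], on the range of [A], and [Q1 *m R11] are injective, so [A] and
    [V1^T] have the same null space as [S *m A = Q1 *m R11 *m V1^T]. *)
Lemma sketch_kernel (R : realType) m n d p (eps : R) (A : 'M[R]_(n, d))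
    (S : 'M[R]_(m, n)) (Q1 : 'M[R]_(m, p)) (R11 : 'M[R]_p)
    (V1 : 'M[R]_(d, p)) (z : 'cV[R]_d) :
  eps < 1 -> subspace_embedding eps S A -> orthonormal_columns Q1 ->
  R11 \in unitmx -> S *m A = Q1 *m R11 *m V1^T ->
  A *m z = 0 <-> V1^T *m z = 0.
Proof.
move=> eps1 emb Q1o R11u SA; split=> [Az0|Vz0].
  have: S *m A *m z = 0 by rewrite -mulmxA Az0 mulmx0.
  rewrite SA -!mulmxA => /(congr1 (mulmx (invmx R11 *m Q1^T))).
  by rewrite mulmx0 -mulmxA (mulmxA Q1^T) Q1o mul1mx mulKmx.
apply: (subspace_embedding_inj eps1 emb).
by rewrite mulmxA SA -mulmxA Vz0 mulmx0.
Qed.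

Theorem theorem9 (R : realType) (m n d r p : nat)
  (A : 'M[R]_(n, d)) (b : 'cV[R]_n) (S : 'M[R]_(m, n)) (eps : R)
  (Q1 : 'M[R]_(m, p)) (Q2 : 'M[R]_(m, d - p))
  (R11 : 'M[R]_p) (R12 : 'M[R]_(p, d - p))
  (V1 : 'M[R]_(d, p)) (V2 : 'M[R]_(d, d - p))
  (W : 'M[R]_(n, p)) (ystar ytau : 'cV[R]_p) (xtau : 'cV[R]_d)
  (hA : \rank A = r) (hdn : (d <= n)%N) (hrd : (r <= d)%N)
  (heps0 : 0 < eps) (heps1 : eps < 1)
  (hS : subspace_embedding eps S (row_mx A b))
  (hSA : sketch_factorization (S *m A) Q1 Q2 R11 R12 V1 V2)
  (hW : W = A *m V1 *m invmx R11)
  (hystar : least_squares_solution W b ystar)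
  (hR12 : R12 = 0)
  (hytau : ytau = ystar)
  (hxtau : xtau = V1 *m invmx R11 *m ytau) :
  unique (min_norm_solution A b) xtau.
Proof.
case: hSA => _ _ /= SA R11u Q1o _ VtV _.
have V1o : V1^T *m V1 = 1%:M.
  by move: VtV; rewrite tr_row_mx mul_col_row scalar_mx_block =>
    /eq_block_mx[].
have {}SA : S *m A = Q1 *m R11 *m V1^T.
  rewrite SA hR12 tr_row_mx mul_row_block mul_row_col.
  by rewrite !mulmx0 !addr0 mul0mx addr0.
have emb := subspace_embedding_lsub hS.
have kerA z := sketch_kernel z heps1 emb Q1o R11u SA.
(* [z - V1 V1^T z] is the [V2] component of [z], which [A] kills. *)
have AVV (z : 'cV[R]_d) : A *m z = A *m (V1 *m (V1^T *m z)).
  apply/eqP; rewrite -subr_eq0 -mulmxBr; apply/eqP; apply/kerA.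
  by rewrite mulmxBr (mulmxA V1^T V1) V1o mul1mx subrr.
rewrite hxtau hytau; apply: lss_orthogonal_kernel_min_norm => [z|w /kerA Vw0].
  have -> : A *m z = W *m (R11 *m (V1^T *m z)).
    by rewrite hW AVV -!mulmxA mulKmx.
  have -> : A *m (V1 *m invmx R11 *m ystar) = W *m ystar.
    by rewrite hW !mulmxA.
  exact: hystar.
by rewrite -mulmxA trmx_mul -mulmxA Vw0 mulmx0.
Qed.
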